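(* Let $r\ge0$ be an integer. For every integer $k\ge0$, as power series in $t$, $$\frac{1}{k!}\Big(\frac{1}{1-t}\Big)^{r}\Big(\frac{1}{1-t}-1\Big)^{k}=\sum_{n=k}^{\infty}L^{r}(n,k)\frac{t^{n}}{n!}.$$
   Context: Falling factorials: $(x)_0=1$, $(x)_n=x(x-1)\cdots(x-n+1)$ for $n\ge1$. Rising factorials: $\langle x\rangle_0=1$, $\langle x\rangle_n=x(x+1)\cdots(x+n-1)$ for $n\ge 1$. For an integer $r\ge0$, the $r$-Lah numbers $L^r(n,k)$ ($0\le k\le n$) are defined by the polynomial identity $\langle x+r\rangle_n=\sum_{k=0}^n L^r(n,k)(x)_k$ for $n\ge0$. *)

(* Defs.v *)
From HB Require Import structures.
From mathcomp Require Import all_boot all_order all_algebra.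
From mathcomp Require Import boolp.

Set Implicit Arguments.
Unset Strict Implicit.
Unset Printing Implicit Defensive.

Import Order.TTheory GRing.Theory Num.Theory.
Local Open Scope ring_scope.

(* [fps R] is the ring R[[t]] of formal power series over R: [Fps a] is        *)
(* sum_n (a n) t^n, and [fcoef f n] is the coefficient of t^n in f.            *)
Record fps (R : Type) := Fps { fcoef : nat -> R }.

Lemma fpsP (R : Type) (f g : fps R) : fcoef f =1 fcoef g -> f = g.
Proof. by case: f g => [f] [g] /= /funext ->. Qed.

HB.instance Definition _ (R : Type) := gen_eqMixin (fps R).
HB.instance Definition _ (R : Type) := gen_choiceMixin (fps R).

Definition fps_zero (R : comUnitRingType) : fps R := Fps (fun=> 0).
Definition fps_opp (R : comUnitRingType) (f : fps R) : fps R :=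
  Fps (fun n => - fcoef f n).
Definition fps_add (R : comUnitRingType) (f g : fps R) : fps R :=
  Fps (fun n => fcoef f n + fcoef g n).

Lemma fps_addA (R : comUnitRingType) : associative (@fps_add R).
Proof. by move=> f g h; apply: fpsP => n /=; rewrite addrA. Qed.
Lemma fps_addC (R : comUnitRingType) : commutative (@fps_add R).
Proof. by move=> f g; apply: fpsP => n /=; rewrite addrC. Qed.
Lemma fps_add0 (R : comUnitRingType) : left_id (fps_zero R) (@fps_add R).
Proof. by move=> f; apply: fpsP => n /=; rewrite add0r. Qed.
Lemma fps_addN (R : comUnitRingType) :
  left_inverse (fps_zero R) (@fps_opp R) (@fps_add R).
Proof. by move=> f; apply: fpsP => n /=; rewrite addNr. Qed.

HB.instance Definition _ (R : comUnitRingType) :=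
  GRing.isZmodule.Build (fps R)
    (@fps_addA R) (@fps_addC R) (@fps_add0 R) (@fps_addN R).

Definition fps_one (R : comUnitRingType) : fps R := Fps (fun n => (n == 0%N)%:R).
Definition fps_mul (R : comUnitRingType) (f g : fps R) : fps R :=
  Fps (fun n => \sum_(i < n.+1) fcoef f i * fcoef g (n - i)%N).

Definition fps_trunc (R : comUnitRingType) (N : nat) (f : fps R) : {poly R} :=
  \poly_(i < N) fcoef f i.

Lemma coef_fps_truncM (R : comUnitRingType) (N n : nat) (f g : fps R) :
  (n < N)%N -> (fps_trunc N f * fps_trunc N g)`_n = fcoef (fps_mul f g) n.
Proof.
move=> ltnN; rewrite coefM /=; apply: eq_bigr => i _.
by rewrite !coef_poly (leq_ltn_trans (leq_ord i) ltnN)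
  (leq_ltn_trans (leq_subr i n) ltnN).
Qed.

Lemma fps_mulC (R : comUnitRingType) : commutative (@fps_mul R).
Proof.
move=> f g; apply: fpsP => n.
by rewrite -!(coef_fps_truncM _ _ (ltnSn n)) mulrC.
Qed.

Lemma fps_mulA (R : comUnitRingType) : associative (@fps_mul R).
Proof.
suff mulE (n : nat) (f g h : fps R) : fcoef (fps_mul f (fps_mul g h)) n
    = (fps_trunc n.+1 f * (fps_trunc n.+1 g * fps_trunc n.+1 h))`_n.
  move=> f g h; apply: fpsP => n.
  by rewrite mulE fps_mulC mulE mulrA mulrC mulrA mulrC mulrA.
rewrite coefM /=; apply: eq_bigr => i _.
by rewrite coef_fps_truncM ?ltnS ?leq_subr // coef_poly ltn_ord.
Qed.

Lemma fps_mul1 (R : comUnitRingType) : left_id (fps_one R) (@fps_mul R).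
Proof.
move=> f; apply: fpsP => n /=.
by rewrite big_ord_recl /= mul1r subn0 big1 ?addr0 // => i _; rewrite mul0r.
Qed.

Lemma fps_mulDl (R : comUnitRingType) :
  left_distributive (@fps_mul R) (@fps_add R).
Proof.
move=> f g h; apply: fpsP => n /=.
by rewrite -big_split; apply: eq_bigr => i _; rewrite mulrDl.
Qed.

Lemma fps_one_neq0 (R : comUnitRingType) : fps_one R != 0.
Proof.
apply/eqP => /(congr1 (fun f => fcoef f 0)) /= /eqP.
by rewrite oner_eq0.
Qed.

HB.instance Definition _ (R : comUnitRingType) :=
  GRing.Zmodule_isComNzRing.Build (fps R) (@fps_mulA R) (@fps_mulC R)
    (@fps_mul1 R) (@fps_mulDl R) (@fps_one_neq0 R).

Definition fps_scale (R : comUnitRingType) (c : R) (f : fps R) : fps R :=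
  Fps (fun n => c * fcoef f n).

Lemma fps_scaleA (R : comUnitRingType) (a b : R) (f : fps R) :
  fps_scale a (fps_scale b f) = fps_scale (a * b) f.
Proof. by apply: fpsP => n /=; rewrite mulrA. Qed.
Lemma fps_scale1 (R : comUnitRingType) : left_id 1 (@fps_scale R).
Proof. by move=> f; apply: fpsP => n /=; rewrite mul1r. Qed.
Lemma fps_scaleDr (R : comUnitRingType) : right_distributive (@fps_scale R) +%R.
Proof. by move=> a f g; apply: fpsP => n /=; rewrite mulrDr. Qed.
Lemma fps_scaleDl (R : comUnitRingType) (f : fps R) :
  {morph (@fps_scale R)^~ f : a b / a + b}.
Proof. by move=> a b; apply: fpsP => n /=; rewrite mulrDl. Qed.

HB.instance Definition _ (R : comUnitRingType) :=
  GRing.Zmodule_isLmodule.Build R (fps R) (@fps_scaleA R) (@fps_scale1 R)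
    (@fps_scaleDr R) (@fps_scaleDl R).

Definition fps_unit (R : comUnitRingType) : pred (fps R) :=
  fun f => fcoef f 0 \is a GRing.unit.

(* For f_0 a unit, 1/f = f_0^-1 * sum_j g^j with g = 1 - f/f_0; only the terms *)
(* j <= n contribute to the coefficient of t^n, since g has no constant term.  *)
(* Outside the units, inversion is the identity, as for any [unitRingType].    *)
Definition fps_inv (R : comUnitRingType) (f : fps R) : fps R :=
  if fps_unit f then
    let c := (fcoef f 0)^-1 in
    Fps (fun n => c * fcoef (\sum_(j < n.+1) (1 - c *: f) ^+ j) n)
  else f.

Lemma fcoef_sum (R : comUnitRingType) (I : Type) (s : seq I) (F : I -> fps R)
    (n : nat) :
  fcoef (\sum_(i <- s) F i) n = \sum_(i <- s) fcoef (F i) n.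
Proof. by elim/big_rec2: _ => // i x y _ <-. Qed.

Lemma fcoefX_small (R : comUnitRingType) (g : fps R) (n j : nat) :
  fcoef g 0 = 0 -> (n < j)%N -> fcoef (g ^+ j) n = 0.
Proof.
move=> g0; elim: j n => [//|j IHj] n ltnj; rewrite exprS /=.
rewrite big_ord_recl /= g0 mul0r add0r big1 // => i _.
rewrite IHj ?mulr0 //; apply: leq_trans (ltnj : (n <= j)%N).
by rewrite ltn_subrL /= (leq_ltn_trans (leq0n i) (ltn_ord i)).
Qed.

Lemma fps_mulVx (R : comUnitRingType) :
  {in @fps_unit R, left_inverse 1 (@fps_inv R) *%R}.
Proof.
move=> f uf; have {}uf : fps_unit f by [].
rewrite /fps_inv uf.
set c := _^-1; set g := 1 - c *: f.
have g0 : fcoef g 0 = 0 by rewrite /= mulVr // subrr.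
apply: fpsP => n.
pose S := \sum_(j < n.+1) g ^+ j.
transitivity (fcoef (S * (c *: f)) n).
  apply: eq_bigr => i _ /=; rewrite [RHS]mulrCA mulrA.
  congr (_ * _ * _); rewrite !fcoef_sum.
  rewrite (big_ord_widen n.+1 (fun j => fcoef (g ^+ j) i)) ?ltn_ord //.
  rewrite [RHS](bigID (fun j : 'I_n.+1 => (j < i.+1)%N)) /= [X in _ = _ + X]big1 ?addr0 //.
  by move=> j; rewrite -leqNgt => ltij; rewrite fcoefX_small.
have -> : c *: f = 1 - g by rewrite /g opprB addrC subrK.
rewrite mulrC -opprB mulNr -subrX1 opprB /=.
by rewrite fcoefX_small // subr0.
Qed.

Lemma fps_unitPl (R : comUnitRingType) (f g : fps R) :
  g * f = 1 -> fps_unit f.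
Proof.
move/(congr1 (fun h => fcoef h 0)); rewrite /= big_ord1 /= subn0 => gf.
by apply/unitrPr; exists (fcoef g 0); rewrite mulrC.
Qed.

Lemma fps_inv_out (R : comUnitRingType) :
  {in [predC @fps_unit R], @fps_inv R =1 id}.
Proof.
by move=> f; rewrite inE /fps_inv; case: (boolP (fps_unit f)) => // uf /negP[].
Qed.

HB.instance Definition _ (R : comUnitRingType) :=
  GRing.ComNzRing_hasMulInverse.Build (fps R)
    (@fps_mulVx R) (@fps_unitPl R) (@fps_inv_out R).

(* The indeterminate t. *)
Definition fpsX (R : comUnitRingType) : fps R := Fps (fun n => (n == 1%N)%:R).

(* The series sum_{n >= k} (a n) t^n. *)
Definition fps_from (R : comUnitRingType) (k : nat) (a : nat -> R) : fps R :=
  Fps (fun n => if (k <= n)%N then a n else 0).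

Definition fallfact (R : nzRingType) (x : R) (n : nat) : R :=
  \prod_(i < n) (x - i%:R).
Definition risefact (R : nzRingType) (x : R) (n : nat) : R :=
  \prod_(i < n) (x + i%:R).

Lemma monic_fallfactX (n : nat) : fallfact ('X : {poly int}) n \is monic.
Proof.
by apply: monic_prod => i _; rewrite -polyC_natr monicXsubC.
Qed.

Lemma size_fallfactX (n : nat) : size (fallfact ('X : {poly int}) n) = n.+1.
Proof.
rewrite /fallfact (eq_bigr (fun i : 'I_n => 'X - (i%:R)%:P)).
  by rewrite -(big_map (fun i : 'I_n => i%:R : int) xpredT (fun a => 'X - a%:P))
    size_prod_XsubC size_map /index_enum -enumT size_enum_ord.
by move=> i _; rewrite polyC_natr.
Qed.

Lemma size_risefactX (r n : nat) :
  size (risefact ('X + r%:R : {poly int}) n) = n.+1.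
Proof.
rewrite /risefact (eq_bigr (fun i : 'I_n => 'X - (- (r + i)%N%:R)%:P)).
  by rewrite -(big_map (fun i : 'I_n => - (r + i)%N%:R : int) xpredT
      (fun a => 'X - a%:P))
    size_prod_XsubC size_map /index_enum -enumT size_enum_ord.
by move=> i _; rewrite polyCN opprK polyC_natr natrD addrA.
Qed.

Lemma fallfactX_free (n : nat) (c : nat -> int) :
  \sum_(k < n) c k *: fallfact ('X : {poly int}) k = 0 ->
  forall k, (k < n)%N -> c k = 0.
Proof.
elim: n => [//|n IHn] sum0.
have cn0 : c n = 0.
  have /(congr1 (fun p : {poly int} => p`_n)) := sum0.
  rewrite big_ord_recr /= coefD coefZ coef_sum coef0 big1 => [|i _]; last first.
    by rewrite coefZ nth_default ?mulr0 // size_fallfactX ltn_ord.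
  have /monicP := monic_fallfactX n.
  by rewrite lead_coefE size_fallfactX /= => ->; rewrite add0r mulr1.
move=> k; rewrite ltnS leq_eqVlt => /predU1P[-> //|]; apply: IHn.
by move: sum0; rewrite big_ord_recr /= cn0 scale0r addr0.
Qed.

Lemma fallfactX_span (n : nat) (p : {poly int}) : (size p <= n)%N ->
  exists c : nat -> int, p = \sum_(k < n) c k *: fallfact 'X k.
Proof.
elim: n p => [|n IHn] p szp.
  by exists (fun=> 0); rewrite big_ord0; apply/eqP; rewrite -size_poly_leq0.
pose q := p - p`_n *: fallfact 'X n.
have [|c qE] := IHn q.
  apply/leq_sizeP => j; rewrite leq_eqVlt coefB coefZ => /predU1P[<-|ltnj].
    have /monicP := monic_fallfactX n.
    by rewrite lead_coefE size_fallfactX /= => ->; rewrite mulr1 subrr.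
  rewrite (nth_default 0 (leq_trans szp ltnj)) sub0r.
  by rewrite [_`_j]nth_default ?size_fallfactX // mulr0 oppr0.
exists (fun k => if k == n then p`_n else c k).
rewrite big_ord_recr /= eqxx (eq_bigr (fun k : 'I_n => c k *: fallfact 'X k)).
  by rewrite -qE subrK.
by move=> i _; rewrite ltn_eqF.
Qed.

Lemma rLah_exists (r n : nat) : exists c : {ffun 'I_n.+1 -> int},
  risefact ('X + r%:R) n == \sum_(k < n.+1) c k *: fallfact ('X : {poly int}) k.
Proof.
have [|c cE] := @fallfactX_span n.+1 (risefact ('X + r%:R) n).
  by rewrite size_risefactX.
exists [ffun k : 'I_n.+1 => c k]; apply/eqP; rewrite {}cE.
by apply: eq_bigr => k _; rewrite ffunE.
Qed.

(* L^r(n, k) for k <= n, set to 0 for k > n: the coefficients chosen by        *)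
(* [xchoose] are the only ones satisfying the identity, cf. [rLah_unique].     *)
Definition rLah (r n k : nat) : int :=
  oapp (xchoose (rLah_exists r n)) 0 (insub k).

Lemma rLahE (r n : nat) :
  risefact ('X + r%:R) n
    = \sum_(k < n.+1) rLah r n k *: fallfact ('X : {poly int}) k.
Proof.
rewrite {1}(eqP (xchooseP (rLah_exists r n))).
by apply: eq_bigr => k _; rewrite /rLah valK.
Qed.

Lemma rLah_unique (r n : nat) (c : nat -> int) :
  risefact ('X + r%:R) n
    = \sum_(k < n.+1) c k *: fallfact ('X : {poly int}) k ->
  forall k, (k <= n)%N -> c k = rLah r n k.
Proof.
rewrite rLahE => /esym/eqP; rewrite -subr_eq0 -sumrB => /eqP sum0 k lekn.
apply/eqP; rewrite -subr_eq0; apply/eqP.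
apply: (@fallfactX_free n.+1 (fun k => c k - rLah r n k)) => //.
by rewrite -[RHS]sum0; apply: eq_bigr => i _; rewrite scalerBl.
Qed.

(* Main.v *)
Require Import Defs.
From mathcomp Require Import all_boot all_order all_algebra.
From mathcomp Require Import ring.

Import GRing.Theory.
Local Open Scope ring_scope.

(** Write [u = 1/(1-t)]. Since [u - 1 = t u], the left-hand side is
    [t^k u^(r+k) / k!], and [u^m = sum_n <m>_n t^n / n!]. On the other side,
    [(x + r + n) (x)_k = (x)_(k+1) + (n + r + k) (x)_k] gives a triangular
    recurrence for the [r]-Lah numbers, which is solved by
    [L^r(j+k, k) = (j+k)!/(k! j!) <r+k>_j]. *)

Lemma risefactSr (R : nzRingType) (x : R) (n : nat) :
  risefact x n.+1 = risefact x n * (x + n%:R).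
Proof. by rewrite /risefact big_ord_recr. Qed.

Lemma risefactSl (R : nzRingType) (x : R) (n : nat) :
  risefact x n.+1 = x * risefact (x + 1) n.
Proof.
rewrite /risefact big_ord_recl addr0; congr (_ * _).
by apply: eq_bigr => i _; rewrite -addrA -[1 + _]mulrS.
Qed.

Lemma fallfactSr (R : nzRingType) (x : R) (n : nat) :
  fallfact x n.+1 = fallfact x n * (x - n%:R).
Proof. by rewrite /fallfact big_ord_recr. Qed.

Lemma rLah_out (r n k : nat) : (n < k)%N -> rLah r n k = 0.
Proof. by move=> ltnk; rewrite /rLah insubN // -leqNgt. Qed.

Lemma rLah_rec (r n k : nat) : (k <= n.+1)%N ->
  rLah r n.+1 k = (if k is k'.+1 then rLah r n k' else 0)
                    + (n + r + k)%:R * rLah r n k.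
Proof.
pose c i : int := (if i is i'.+1 then rLah r n i' else 0)
                    + (n + r + i)%:R * rLah r n i.
move=> lekn; rewrite -/(c k); symmetry; move: k lekn.
(* By uniqueness of coefficients, it suffices that [c] expands the identity at [n] multiplied by its
   new factor ['X + r + n]. *)
apply: rLah_unique; rewrite risefactSr rLahE mulr_suml.
rewrite (eq_bigr (fun i : 'I_n.+2 =>
    (if i : nat is i'.+1 then rLah r n i' else 0) *: fallfact 'X i
    + ((n + r + i)%:R * rLah r n i) *: fallfact ('X : {poly int}) i)); last first.
  by move=> i _; rewrite /c scalerDl.
(* The first sum loses its zero term at 0 and is reindexed; the second loses its top term, as
   [rLah r n n.+1 = 0]. Both then run over [i <= n]. *)
rewrite big_split /= [in RHS]big_ord_recl scale0r add0r.
rewrite [X in _ = _ + X]big_ord_recr /= (rLah_out r n n.+1) // mulr0 scale0r addr0.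
rewrite -big_split; apply: eq_bigr => i _ /=.
rewrite -scalerAl add0n fallfactSr -scalerA.
rewrite [in RHS]scalerA [_%:R * _]mulrC -scalerA -scalerDr; congr (_ *: _).
by rewrite scaler_nat -[_ *+ (n + r + i)]mulr_natr !natrD; ring.
Qed.

Lemma rLah_diag (r n : nat) : rLah r n n = 1.
Proof.
elim: n => [|n IHn].
  symmetry; apply: (@rLah_unique r 0 (fun=> 1)) => //.
  by rewrite big_ord1 scale1r /risefact /fallfact !big_ord0.
by rewrite rLah_rec // IHn rLah_out // mulr0 addr0.
Qed.

Lemma fact_neq0 (R : numFieldType) (n : nat) : n`!%:R != 0 :> R.
Proof. by rewrite Num.Theory.pnatr_eq0 -lt0n fact_gt0. Qed.

(** The shape in which [field] meets the successors from factorials once [mulrS] has unfolded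
    them. *)
Lemma nat1r_neq0 (R : numFieldType) (n : nat) : 1 + n%:R != 0 :> R.
Proof. by rewrite -mulrS Num.Theory.pnatr_eq0. Qed.

(** Induction on [j], then on [k]: the recurrence reduces [(j+1, k+1)] to [(j+1, k)] and [(j, k+1)].
    Writing the upper index as [j + k] avoids truncated subtraction. *)
Lemma rLah_closed (R : numFieldType) (r k j : nat) :
  (rLah r (j + k) k)%:~R
    = (j + k)`!%:R / k`!%:R * (risefact (r + k)%:R j / j`!%:R) :> R.
Proof.
elim: j k => [|j IHj] k.
  by rewrite rLah_diag /risefact big_ord0 divr1 mulr1 divff ?fact_neq0.
elim: k => [|k IHk].
  rewrite addn0 rLah_rec // add0r intrM -{2}[j]addn0 IHj !addn0 risefactSr.
  rewrite natz -pmulrn factS natrM !natrD [j.+1%:R]mulrS.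
  by field; rewrite !fact_neq0 nat1r_neq0.
rewrite addnS rLah_rec ?ltnS ?leq_addl // intrD intrM natz -pmulrn
  [in rLah r _ k.+1]addSnnS.
(* Peeling the first factor on the left and the last on the right leaves the common factor
   [<r+k+1>_j], abstracted below as [y]. *)
rewrite IHj IHk risefactSl [in RHS]risefactSr.
have -> : (r + k.+1)%:R = (r + k)%:R + 1 :> R by rewrite addnS mulrS addrC.
move: (risefact _ j) => y.
rewrite !addSnnS !addnS !factS !natrM !addSn !mulrS !natrD.
by field; rewrite !fact_neq0 !nat1r_neq0.
Qed.

Lemma fcoef_sub1X (R : comUnitRingType) (f : fps R) (n : nat) :
  fcoef ((1 - fpsX R) * f) n
    = fcoef f n - (if n is n'.+1 then fcoef f n' else 0).
Proof.
rewrite mulrBl mul1r [LHS]/=; congr (_ - _).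
case: n => [|n]; first by rewrite big_ord1 mul0r.
rewrite !big_ord_recl /= mul0r add0r mul1r subSS subn0.
by rewrite big1 ?addr0 // => i _; rewrite mul0r.
Qed.

Lemma unit_sub1X (R : comUnitRingType) : 1 - fpsX R \is a GRing.unit.
Proof. by rewrite unfold_in /= /fps_unit /= subr0 unitr1. Qed.

Lemma fcoef_XnM (R : comUnitRingType) (f : fps R) (k n : nat) :
  fcoef (fpsX R ^+ k * f) n = if (k <= n)%N then fcoef f (n - k) else 0.
Proof.
have fcoef_XM (g : fps R) m :
    fcoef (fpsX R * g) m = if m is m'.+1 then fcoef g m' else 0.
  (* Multiplication by [t] is read off from that by [1 - t]. *)
  have := fcoef_sub1X R g m; rewrite mulrBl mul1r [LHS]/=.
  by move/addrI/oppr_inj.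
elim: k n => [|k IHk] n; first by rewrite expr0 mul1r subn0.
by rewrite exprS -mulrA fcoef_XM; case: n => [//|n]; rewrite IHk ltnS subSS.
Qed.

(** Induction on [m]: multiplying by [1 - t] takes backward differences of coefficients, which turns
    [<m+1>_n / n!] into [<m>_n / n!]. *)
Lemma fcoef_inv_sub1X_exp (R : numFieldType) (m n : nat) :
  fcoef ((1 / (1 - fpsX R)) ^+ m) n = risefact m%:R n / n`!%:R.
Proof.
suff -> : (1 / (1 - fpsX R)) ^+ m = Fps (fun n => risefact m%:R n / n`!%:R) by [].
elim: m => [|m IHm].
  apply: fpsP => -[|i]; first by rewrite /= /risefact big_ord0 divr1.
  by rewrite /= risefactSl !mul0r.
rewrite exprS IHm mul1r; apply: (canLR (mulKr (unit_sub1X R))).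
apply: fpsP => -[|i]; rewrite fcoef_sub1X /=.
  by rewrite /risefact !big_ord0 subr0.
(* With [<m+1>_i] factored out, what remains is [(m+1+i) - (i+1) = m]. *)
rewrite [in RHS]risefactSr risefactSl [m.+1%:R]mulrS [1 + m%:R]addrC.
rewrite factS natrM [i.+1%:R]mulrS.
by field; rewrite fact_neq0 nat1r_neq0.
Qed.

Theorem mainTheorem7 (r k : nat) :
  (1 / k`!%:R : rat) *: ((1 / (1 - fpsX rat)) ^+ r * (1 / (1 - fpsX rat) - 1) ^+ k)
  = fps_from k (fun n => (rLah r n k)%:~R / n`!%:R).
Proof.
have uE : 1 / (1 - fpsX rat) - 1 = fpsX rat * (1 / (1 - fpsX rat)).
  (* After multiplication by the unit [1 - t], both sides equal [t]. *)
  apply: (mulrI (unit_sub1X rat)).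
  by rewrite mulrBr [in RHS]mulrCA !mul1r mulr1 divrr ?unit_sub1X //
    mulr1 opprB addrC subrK.
rewrite uE [(fpsX rat * _) ^+ k]exprMn mulrCA -exprD; apply: fpsP => n.
transitivity (1 / k`!%:R *
    fcoef (fpsX rat ^+ k * (1 / (1 - fpsX rat)) ^+ (r + k)) n) => //.
rewrite fcoef_XnM /=; case: leqP => [lekn|_]; last by rewrite mulr0.
(* Writing [n] as [(n - k) + k] makes the closed form apply with [j = n - k]; then [n!] cancels. *)
rewrite fcoef_inv_sub1X_exp -{3 4}(subnK lekn) rLah_closed.
by field; rewrite !fact_neq0.
Qed.
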